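(* Suppose $X$ has a minimum or a maximum. Let $Y$ be a nonempty proper convex subset of $X$. If $Y$ has a minimum or a maximum, then $\operatorname{rank}(\mathcal{OP}(X,Y):\mathcal{O}(X,Y))=1$.
   Context: Maps are written on the right of their arguments and composed from left to right. Throughout, $X$ is an infinite linearly ordered set that is dense (for all $x<y$ in $X$ there is $z\in X$ with $x<z<y$). A subset $C\subseteq X$ is convex if $x,y\in C$, $z\in X$ and $x<z<y$ imply $z\in C$; an open convex subset of $X$ is a nonempty convex subset of $X$ having neither a minimum nor a maximum. For sets, $A<B$ means $a<b$ for all $a\in A$, $b\in B$. It is assumed that $X$ satisfies: (a) if $X=X'\cup X''$ with $X'<X''$ and $X',X''\neq\emptyset$, then $X'$ has a maximum or $X''$ has a minimum; (b) any two open convex subsets of $X$ are order-isomorphic (i.e., there is an order-preserving bijection between them). $\mathcal{T}(X)$ is the monoid of all maps $X\to X$ under composition, and $\mathcal{O}(X)$ is its submonoid of order-preserving maps ($x\le y$ implies $x\alpha\le y\alpha$). A map $\alpha\in\mathcal{T}(X)$ is orientation-preserving if there is a nonempty subset $X_1\subseteq X$ such that, with $X_2=X\setminus X_1$: (1) $\alpha$ is order-preserving on $X_1$ and on $X_2$; and (2) for all $p\in X_1$ and $q\in X_2$, $p<q$ and $p\alpha\ge q\alpha$. $\mathcal{OP}(X)$ is the monoid of all orientation-preserving maps on $X$. For a nonempty $Y\subseteq X$, $\mathcal{O}(X,Y)=\{\alpha\in\mathcal{O}(X):\operatorname{im}\alpha\subseteq Y\}$ and $\mathcal{OP}(X,Y)=\{\alpha\in\mathcal{OP}(X):\operatorname{im}\alpha\subseteq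 Y\}$; these are semigroups with $\mathcal{O}(X,Y)\subseteq\mathcal{OP}(X,Y)$. For a semigroup $S$ and $A\subseteq S$, the relative rank $\operatorname{rank}(S:A)$ is the minimal cardinality of a set $B\subseteq S$ such that $A\cup B$ generates $S$.
   Formalization: Y is additionally assumed to have at least two points: for a singleton Y both semigroups consist of one constant map, so the relative rank is 0 and the claim as printed fails. *)

(* Defs.v *)
From mathcomp Require Import all_boot all_order.
From mathcomp Require Import boolp classical_sets functions cardinality.

Set Implicit Arguments.
Unset Strict Implicit.
Unset Printing Implicit Defensive.

Import Order.TTheory.
Local Open Scope classical_set_scope.
Local Open Scope order_scope.

Section Chains.
Context {d : Order.disp_t} {X : orderType d}.
Implicit Types (A B C D Y : set X) (f : X -> X).

Definition has_min A := exists2 m, A m & lbound A m.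
Definition has_max A := exists2 m, A m & ubound A m.

Definition set_lt A B := forall a b, A a -> B b -> a < b.

Definition convex C := forall x y z, C x -> C y -> x < z -> z < y -> C z.

Definition open_convex C := [/\ C !=set0, convex C, ~ has_min C & ~ has_max C].

Definition order_preserving_on A f := {in A &, {homo f : x y / x <= y}}.

(* As A and B are compared inside the inhabited chain X, every map from A to B
   is the restriction of a total map on X. *)
Definition order_isomorphic A B :=
  exists2 f, set_bij A B f & order_preserving_on A f.

Definition orientation_preserving f :=
  exists2 X1 : set X, X1 !=set0 &
    [/\ order_preserving_on X1 f, order_preserving_on (~` X1) f &
        forall p q, X1 p -> (~` X1) q -> p < q /\ f q <= f p].

Definition O_restr Y : set (X -> X) :=
  [set f | order_preserving_on [set: X] f /\ range f `<=` Y].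

Definition OP_restr Y : set (X -> X) :=
  [set f | orientation_preserving f /\ range f `<=` Y].

End Chains.

Definition dense_chain {d} (X : orderType d) :=
  forall x y : X, x < y -> exists z, x < z /\ z < y.

Definition no_gap_cut {d} (X : orderType d) :=
  forall A B : set X, A `|` B = [set: X] -> set_lt A B ->
    A !=set0 -> B !=set0 -> has_max A \/ has_min B.

Definition homogeneous_chain {d} (X : orderType d) :=
  forall A B : set X, open_convex A -> open_convex B -> order_isomorphic A B.

Section RelativeRank.
Local Open Scope card_scope.
Context {T : Type}.
Implicit Types S A B M : set (T -> T).

(* Maps are written on the right: the product of f and g is f followed by g. *)
Definition product_closed M := forall f g, M f -> M g -> M (f \; g).

Definition generated_semigroup A := smallest product_closed A.

Definition generates_modulo S A B :=
  B `<=` S /\ generated_semigroup (A `|` B) = S.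

(* A cardinal is represented by a set K having that cardinality. *)
Definition relative_rank_is {U : Type} S A (K : set U) :=
  (exists2 B, generates_modulo S A B & B #= K) /\
  forall B, generates_modulo S A B -> K #<= B.

End RelativeRank.

(* Main.v *)
Require Import Defs.
From mathcomp Require Import all_boot all_order.
From mathcomp Require Import boolp classical_sets functions cardinality.

Import Order.TTheory.
Local Open Scope classical_set_scope.
Local Open Scope order_scope.

(** Dualising the chain, [Y] may be assumed to have a maximum [M]. Choose
[z < p < c < M] in [Y]. Homogeneity gives a rotation [g] of [Y], constant or an
isomorphism on each of the pieces cut out by [p], [c] and [M], that exchanges
the part of [Y] below [c] with the part above it, and an orientation-preserving
map [s] into [Y], all of whose values are at least [p], that is a section of [g]
over [Y] without its possible minimum ([rotation_with_section]). The map [g] alone generates [OP_restr Y] modulo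
[O_restr Y]:

- Let [h] be a map of [OP_restr Y] bounded below by a point of [Y], with blocks
  [A] and its complement. By homogeneity, the whole chain embeds both in the
  interval from [c] to [M] and in the interval from [p] to [c]. Let [e] be the
  first embedding on [A] and the second one on the complement. Then [e]
  followed by [s] is order-preserving, [s] followed by [g] fixes the values of
  [e], and since [h] depends monotonically on the value of [e], it is [e]
  followed by an order-preserving map [k], obtained from suprema
  ([order_preserving_interpolation]). So [h] is the product of an
  order-preserving map, [g] and [k].
- If [f] in [OP_restr Y] has no lower bound in [Y], then [Y] has no minimum, so
  [s] followed by [g] is the identity on the whole of [Y]. Hence [f] is
  [f] followed by [s], a map bounded below by [p] and covered by the previous
  case, followed by [g].

As [g] itself is not order-preserving and [O_restr Y] is a semigroup, the empty
set of generators does not suffice. *)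

(** * Semigroups of maps and relative rank *)

Lemma product_closed_generated (T : Type) (A : set (T -> T)) :
  product_closed (generated_semigroup A).
Proof.
move=> f g Af Ag M clAM; have [clM _] := clAM.
by apply: clM; [exact: (Af M) | exact: (Ag M)].
Qed.

Lemma sub_generated (T : Type) (A : set (T -> T)) : A `<=` generated_semigroup A.
Proof. exact: sub_gen_smallest. Qed.

Lemma generated_sub (T : Type) (A S : set (T -> T)) :
  product_closed S -> A `<=` S -> generated_semigroup A `<=` S.
Proof. by move=> clS AS; apply: smallest_sub. Qed.

(** If [A] is itself closed under products and differs from [S], then the empty
set does not generate [S] modulo [A], so a single generator is optimal. *)
Lemma relative_rank1 (T : Type) (S A : set (T -> T)) (g : T -> T) :
  product_closed S -> product_closed A -> A `<=` S -> S g -> ~ A g ->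
  S `<=` generated_semigroup (A `|` [set g]) ->
  relative_rank_is S A `I_1.
Proof.
move=> clS clA AS Sg nAg Sgen; split.
  exists [set g]; last exact: card_set1.
  split; first by move=> _ ->.
  apply/seteqP; split=> //; apply: generated_sub => //.
  by move=> f [/AS//|->].
move=> B [BS genB].
have [b Bb] : B !=set0.
  apply/set0P/eqP => B0; apply: nAg.
  have := Sg; rewrite -genB B0 setU0.
  exact: generated_sub.
have b_le_B : ([set b] #<= B)%card by apply: subset_card_le => _ ->.
apply: card_le_trans b_le_B.
by have /card_eqPle[] := @card_set1 _ b.
Qed.

(** * Orientation-preserving maps *)

Section Chain.
Context {d : Order.disp_t} {X : orderType d}.
Implicit Types (A B C Y : set X) (f g h s : X -> X) (a b c p x y : X).

Lemma order_preserving_onP A f :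
  order_preserving_on A f <->
  forall x y, A x -> A y -> x <= y -> f x <= f y.
Proof.
split=> [mf x y Ax Ay|mf x y]; first by apply: mf; rewrite inE.
by rewrite !inE; apply: mf.
Qed.

Lemma orientation_preserving_blocks f : orientation_preserving f -> exists A,
  [/\ forall x y, A x -> A y -> x <= y -> f x <= f y,
      forall x y, ~ A x -> ~ A y -> x <= y -> f x <= f y &
      forall p q, A p -> ~ A q -> p < q /\ f q <= f p].
Proof.
by move=> [A _ [/order_preserving_onP mA /order_preserving_onP mC AC]]; exists A.
Qed.

(** On an inhabited chain, the requirement that the first block be nonempty is
harmless: when it is empty, the whole chain can be taken as the first block. *)
Lemma blocks_orientation_preserving (x0 : X) A f :
  (forall x y, A x -> A y -> x <= y -> f x <= f y) ->
  (forall x y, ~ A x -> ~ A y -> x <= y -> f x <= f y) ->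
  (forall p q, A p -> ~ A q -> p < q /\ f q <= f p) ->
  orientation_preserving f.
Proof.
move=> mA mC AC; have [A0|A0] := pselect (A !=set0).
  by exists A => //; split=> //; apply/order_preserving_onP.
have nA x : ~ A x by move=> Ax; apply: A0; exists x.
exists setT; first by exists x0.
split; first by apply/order_preserving_onP => x y _ _; apply: mC.
  by apply/order_preserving_onP => x y [].
by move=> p q _ [].
Qed.

Lemma product_closed_O_restr Y : product_closed (O_restr Y).
Proof.
move=> f g [/order_preserving_onP mf Yf] [/order_preserving_onP mg Yg]; split.
  by apply/order_preserving_onP => x y _ _ xy; apply: mg => //; apply: mf.
by move=> _ [x _ <-]; apply: Yg; exists (f x).
Qed.

Lemma sub_O_OP_restr Y : Y !=set0 -> O_restr Y `<=` OP_restr Y.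
Proof.
move=> [y0 _] f [mf Yf]; split=> //; exists setT; first by exists y0.
by split=> //; apply/order_preserving_onP => x y [].
Qed.

(** The preimages under [f] of the blocks of [g] refine the two blocks of [f]
into at most three nonempty pieces, because the values of [f] on its second
block lie below those on its first one. Merging two consecutive pieces gives
the blocks of the product; which two depends on the block of [f] that [g]
splits. *)
Lemma orientation_preserving_comp f g :
  orientation_preserving f -> orientation_preserving g ->
  orientation_preserving (f \; g).
Proof.
move=> OPf; have [x0 _] : [set: X] !=set0 by case: OPf => A [x0 _] _; exists x0.
have [A [fA fC fAC]] := orientation_preserving_blocks _ OPf.
move=> /orientation_preserving_blocks[B [gB gC gBC]].
have Bdown x y : x <= y -> B y -> B x.
  by move=> xy By; apply: contrapT => /(gBC _ _ By)[]; rewrite ltNge xy.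
(* If a point of the second block of f is mapped to the second block of g, then
   so is the whole first block of f. *)
have [[z nAz nBfz]|noz] := pselect (exists2 z, ~ A z & ~ B (f z)).
  have nBA x : A x -> ~ B (f x).
    by move=> Ax /(Bdown _ _ (fAC _ _ Ax nAz).2).
  apply: (blocks_orientation_preserving x0 [set x | A x \/ B (f x)]).
  - move=> x y /= [Ax|Bx] [Ay|By] xy.
    + by apply: gC; [exact: nBA | exact: nBA | exact: fA].
    + by apply: (gBC _ _ By (nBA _ Ax)).2.
    + have nAx : ~ A x by move/nBA.
      by have := (fAC _ _ Ay nAx).1; rewrite ltNge xy.
    + by apply: gB => //; apply: fC => //; move/nBA.
  - move=> x y /= /not_orP[nAx nBx] /not_orP[nAy nBy] xy.
    by apply: gC => //; apply: fC.
  - move=> x y /= ABx /not_orP[nAy nBy]; case: ABx => [Ax|Bx].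
      have [xy fyx] := fAC _ _ Ax nAy; split=> //.
      by apply: gC => //; apply: nBA.
    have nAx : ~ A x by move/nBA.
    split; last exact: (gBC _ _ Bx nBy).2.
    rewrite ltNge; apply/negP => yx.
    exact: nBy (Bdown _ _ (fC _ _ nAy nAx yx) Bx).
have BC x : ~ A x -> B (f x).
  by move=> nAx; apply: contrapT => nBx; apply: noz; exists x.
apply: (blocks_orientation_preserving x0 [set x | A x /\ B (f x)]).
- by move=> x y /= [Ax Bx] [Ay By] xy; apply: gB => //; apply: fA.
- move=> x y /= nABx nABy xy.
  have [Ax|nAx] := pselect (A x).
    have nBx : ~ B (f x) by move=> Bx; apply: nABx.
    have [Ay|nAy] := pselect (A y); last exact: (gBC _ _ (BC _ nAy) nBx).2.
    by apply: gC; [|by move=> By; apply: nABy|exact: fA].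
  have [Ay|nAy] := pselect (A y).
    by have := (fAC _ _ Ay nAx).1; rewrite ltNge xy.
  by apply: gB; [exact: BC|exact: BC|exact: fC].
- move=> x y /= [Ax Bx] nABy.
  have [Ay|nAy] := pselect (A y); last first.
    have [xy fyx] := fAC _ _ Ax nAy; split=> //.
    by apply: gB => //; apply: BC.
  have nBy : ~ B (f y) by move=> By; apply: nABy.
  split; last exact: (gBC _ _ Bx nBy).2.
  rewrite ltNge; apply/negP => yx.
  exact: nBy (Bdown _ _ (fA _ _ Ay Ax yx) Bx).
Qed.

Lemma product_closed_OP_restr Y : product_closed (OP_restr Y).
Proof.
move=> f g [OPf _] [OPg Yg]; split; first exact: orientation_preserving_comp.
by move=> _ [x _ <-]; apply: Yg; exists (f x).
Qed.

(** * Suprema and interpolation *)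

(** The cut axiom makes the chain conditionally complete. *)
Lemma exists_sup A b : no_gap_cut X -> A !=set0 -> ubound A b ->
  exists u, ubound A u /\ forall v, ubound A v -> u <= v.
Proof.
move=> Xcut [a0 Aa0] Ab.
(* Cut the chain at the downward closure D of A. *)
pose D := [set x | exists2 a, A a & x <= a].
have nD x : ~ D x -> forall a, A a -> a < x.
  by move=> nDx a Aa; rewrite ltNge; apply/negP => xa; apply: nDx; exists a.
have max_sup m : D m -> ubound D m ->
    exists u, ubound A u /\ forall v, ubound A v -> u <= v.
  move=> [a Aa ma] Dm; exists m; split=> [x Ax|v Av].
    by apply: Dm; exists x.
  exact: le_trans ma (Av _ Aa).
have [[x0 nDx0]|allD] := pselect (~` D !=set0); last first.
  have Db : D b by apply: contrapT => nDb; apply: allD; exists b.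
  by apply: (max_sup b) => // x [a Aa /le_trans]; apply; apply: Ab.
have [||||[m Dm ubm]|[m nDm lbm]] := Xcut D (~` D).
- exact: setUv.
- move=> x y [a Aa xa] nDy; exact: le_lt_trans xa (nD _ nDy _ Aa).
- by exists a0; exists a0.
- by exists x0.
- exact: (max_sup m).
- have [Dv|] := pselect (exists2 v, ubound A v & v < m).
    case: Dv => v Av vm; have Dv : D v.
      by apply: contrapT => /lbm; rewrite leNgt vm.
    by apply: (max_sup v) => // x [a Aa /le_trans]; apply; apply: Av.
  move=> nov; exists m; split=> [a Aa|v Av]; first exact/ltW/(nD _ nDm).
  by rewrite leNgt; apply/negP => vm; apply: nov; exists v.
Qed.

(** If [h] factors monotonically through [e], the connecting map can be chosen
order-preserving on the whole chain, with the bounds of [h]. *)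
Lemma order_preserving_interpolation (e h : X -> X) b M :
  no_gap_cut X -> (forall x, b <= h x) -> (forall x, h x <= M) ->
  (forall x y, e x <= e y -> h x <= h y) ->
  exists k : X -> X, [/\ forall x y, x <= y -> k x <= k y,
    forall x, b <= k x, forall x, k x <= M & forall x, k (e x) = h x].
Proof.
move=> Xcut bh hM eh.
(* The bound b keeps the set nonempty when y lies below all values of e. *)
pose D y := [set z | z = b \/ exists2 x, e x <= y & z = h x].
have DM y : ubound (D y) M.
  move=> z [->|[x _ ->]] //; exact: le_trans (bh M) (hM M).
have supD y : exists u, ubound (D y) u /\ forall v, ubound (D y) v -> u <= v.
  by apply: (exists_sup _ M Xcut) => //; exists b; left.
have [k kP] := choice supD.
exists k; split=> [x y xy|x|x|x].
- apply: (kP x).2 => z Dz; apply: (kP y).1; case: Dz => [->|[w wx ->]].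
    by left.
  by right; exists w => //; apply: le_trans wx xy.
- by apply: (kP x).1; left.
- exact: (kP x).2.
- apply/eqP; rewrite eq_le; apply/andP; split.
    by apply: (kP _).2 => z [->|[w wx ->]] //; apply: eh.
  by apply: (kP _).1; right; exists x.
Qed.

(** * Open convex subsets and order embeddings *)

(** The subset [C] with its possible minimum and maximum removed. *)
Definition convex_interior C :=
  [set x | [/\ C x, exists2 y, C y & y < x & exists2 z, C z & x < z]].

Lemma open_convex_interior C x y :
  dense_chain X -> convex C -> C x -> C y -> x < y ->
  open_convex (convex_interior C).
Proof.
move=> Xdense Ccvx Cx Cy xy; split.
- have [z [xz zy]] := Xdense _ _ xy; exists z; split; last by exists y.
    exact: Ccvx xz zy.
  by exists x.
- move=> a b c [Ca [a' Ca' a'a] _] [Cb _ [b' Cb' bb']] ac cb; split.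
  + exact: Ccvx ac cb.
  + by exists a.
  + by exists b.
- move=> [m [Cm [a Ca am] [b Cb mb]] lbm].
  have [z [az zm]] := Xdense _ _ am.
  have : convex_interior C z.
    by split; [exact: Ccvx az zm | exists a | exists m].
  by move/lbm; rewrite leNgt zm.
- move=> [m [Cm [a Ca am] [b Cb mb]] ubm].
  have [z [mz zb]] := Xdense _ _ mb.
  have : convex_interior C z.
    by split; [exact: Ccvx mz zb | exists m | exists b].
  by move/ubm; rewrite leNgt mz.
Qed.

Lemma open_convex_interval a b : dense_chain X -> a < b ->
  open_convex [set x : X | a < x /\ x < b].
Proof.
move=> Xdense ab; pose C := [set x : X | a <= x /\ x <= b].
have Ca : C a by split=> //; exact: ltW.
have Cb : C b by split=> //; exact: ltW.
suff -> : [set x : X | a < x /\ x < b] = convex_interior C.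
  apply: (open_convex_interior _ a b) => //.
  move=> x y z [ax _] [_ yb] xz zy; split.
    exact: le_trans ax (ltW xz).
  exact: le_trans (ltW zy) yb.
apply/seteqP; split=> x /=.
  by move=> [ax xb]; split; [split; exact: ltW | exists a | exists b].
by move=> [_ [y [ay _] yx] [z [_ zb] xz]]; split;
  [exact: le_lt_trans yx | exact: lt_le_trans zb].
Qed.

(** Order-isomorphic subsets are related by a map and a section of it that is
an order embedding. *)
Lemma order_isomorphic_section A B : order_isomorphic A B ->
  exists f s, [/\ forall x, A x -> B (f x),
    forall x y, A x -> A y -> x <= y -> f x <= f y,
    forall y, B y -> A (s y),
    forall x y, B x -> B y -> (s x <= s y) = (x <= y) &
    forall y, B y -> f (s y) = y].
Proof.
move=> [f [fAB _ fsurj] /order_preserving_onP mf].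
have preim y : exists x, B y -> A x /\ f x = y.
  have [By|nBy] := pselect (B y); last by exists y.
  by have [x Ax fx] := fsurj y By; exists x.
have [s sP] := choice preim.
exists f, s; split=> //.
- by move=> y /sP[].
- move=> x y Bx By; have [Asx fsx] := sP x Bx; have [Asy fsy] := sP y By.
  apply/idP/idP => [sxy|xy]; first by rewrite -fsx -fsy; apply: mf.
  rewrite leNgt; apply/negP => syx; have := mf _ _ Asy Asx (ltW syx).
  rewrite fsx fsy => yx; have e : x = y by apply: le_anti; rewrite xy yx.
  by move: syx; rewrite e ltxx.
- by move=> y /sP[].
Qed.

(** The chain without its endpoints is isomorphic to a smaller interval, whose
ends are then the images of the endpoints, if any. *)
Lemma order_embedding_interval a b :
  dense_chain X -> homogeneous_chain X -> a < b ->
  exists e : X -> X, [/\ forall x y, (e x <= e y) = (x <= y),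
    forall x, a < e x & forall x, e x < b].
Proof.
move=> Xdense Xhom ab.
have [a' [aa' a'b]] := Xdense _ _ ab.
have [b' [a'b' b'b]] := Xdense _ _ a'b.
pose I := convex_interior [set: X].
have oI : open_convex I by apply: (open_convex_interior _ a b).
have oJ := open_convex_interval a' b' Xdense a'b'.
have [_ [s [_ _ sI sle _]]] := order_isomorphic_section _ _ (Xhom _ _ oJ oI).
pose e x := if x \in I then s x else if `[< forall y, x <= y >] then a' else b'.
have eI x : I x -> e x = s x by move=> Ix; rewrite /e mem_set.
have nI_lt x y : x < y -> ~ I x -> e x = a'.
  move=> xy nIx; rewrite /e memNset //; case: asboolP => // nbot.
  case: nIx; split=> //; last by exists y.
  have /existsNP[z /negP] := nbot; rewrite -ltNge => zx.
  by exists z.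
have nI_gt x y : y < x -> ~ I x -> e x = b'.
  move=> yx nIx; rewrite /e memNset //; case: asboolP => // /(_ y).
  by rewrite leNgt yx.
have e_lt : {homo e : x y / x < y}.
  move=> x y xy; have [Ix|nIx] := pselect (I x); have [Iy|nIy] := pselect (I y).
  - by rewrite !eI // ltNge sle // -ltNge.
  - by rewrite (nI_gt y x) // eI //; case: (sI _ Ix).
  - by rewrite (nI_lt x y) // eI //; case: (sI _ Iy).
  - by rewrite (nI_lt x y) // (nI_gt y x).
have e_bounds x : a' <= e x /\ e x <= b'.
  have [Ix|nIx] := pselect (I x).
    by rewrite eI //; have [/ltW ? /ltW] := sI _ Ix.
  by rewrite /e memNset //; case: ifP => _; split=> //; exact: ltW.
exists e; split=> [x y|x|x].
- exact: (le_mono e_lt).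
- exact: lt_le_trans aa' (e_bounds x).1.
- exact: le_lt_trans (e_bounds x).2 b'b.
Qed.

(** * A rotation and its section *)

(** [lower_part Y c] consists of the points of [Y] below [c], except for the
minimum of [Y] if there is one. *)
Definition lower_part Y c :=
  [set y | [/\ Y y, y < c & exists2 z, Y z & z < y]].

Lemma open_convex_lower_part Y z c : dense_chain X -> convex Y ->
  Y z -> Y c -> z < c -> open_convex (lower_part Y c).
Proof.
move=> Xdense Ycvx Yz Yc zc; pose C := [set y | Y y /\ y <= c].
suff -> : lower_part Y c = convex_interior C.
  apply: (open_convex_interior _ z c) => //; last by split=> //; exact: ltW.
  move=> a b e [Ya ac] [Yb bc] ae eb; split; first exact: Ycvx ae eb.
  exact: le_trans (ltW eb) bc.
apply/seteqP; split=> y /=.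
  move=> [Yy yc [w Yw wy]]; split.
  - by split=> //; exact: ltW.
  - by exists w => //; split=> //; apply: ltW; apply: lt_trans yc.
  - by exists c.
move=> [[Yy yc] [w [Yw _] wy] [v [_ vc] yv]]; split=> //.
  exact: lt_le_trans vc.
by exists w.
Qed.

(** The map [g] is a rotation of [Y] that exchanges its part below [c] with its
part above [c]; [s] turns it back, except at the minimum of [Y] if there is one,
and avoids the points below [p]. This is possible because [g] takes all the
values from [c] to [M] on the points from [p] to [c]. *)
Lemma rotation_with_section Y z p c M :
  dense_chain X -> homogeneous_chain X -> convex Y -> Y z -> Y M ->
  z < p -> p < c -> c < M ->
  exists g s, [/\
    [/\ OP_restr Y g, ~ O_restr Y g & OP_restr Y s],
    [/\ forall x, p <= s x,
        forall x y, c <= x -> x <= y -> s x <= s y,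
        forall x y, lower_part Y c x -> lower_part Y c y -> x <= y -> s x <= s y &
        forall x y, lower_part Y c x -> c <= y -> s y <= s x],
    forall y, lower_part Y c y -> g (s y) = y &
    forall y, c <= y -> y <= M -> g (s y) = y].
Proof.
move=> Xdense Xhom Ycvx Yz YM zp pc cM.
have zc := lt_trans zp pc; have pM := lt_trans pc cM.
have Yz_M x : z < x -> x <= M -> Y x.
  by move=> zx; rewrite le_eqVlt => /predU1P[->//|]; apply: Ycvx zx.
have Yc : Y c by apply: Yz_M => //; exact: ltW.
have oL := open_convex_lower_part Y z c Xdense Ycvx Yz Yc zc.
have ocM := open_convex_interval c M Xdense cM.
have opc := open_convex_interval p c Xdense pc.
have [phi [phi' [phiL mphi phi'cM mphi' phiK]]] :=
  order_isomorphic_section _ _ (Xhom _ _ ocM oL).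
have [psi [psi' [psicM mpsi psi'pc mpsi' psiK]]] :=
  order_isomorphic_section _ _ (Xhom _ _ opc ocM).
pose g x := if x <= p then c else if x < c then psi x else
  if x == c then M else if x < M then phi x else c.
have g_bot x : x <= p -> g x = c by rewrite /g => ->.
have g_mid x : p < x -> x < c -> g x = psi x.
  by rewrite /g ltNge => /negPf-> ->.
have g_c : g c = M by rewrite /g leNgt pc ltxx eqxx.
have g_up x : c < x -> x < M -> g x = phi x.
  by move=> cx xM; rewrite /g leNgt (lt_trans pc cx) ltNge (ltW cx) gt_eqF // xM.
have g_top x : M <= x -> g x = c.
  move=> Mx; have cx := lt_le_trans cM Mx.
  by rewrite /g leNgt (lt_trans pc cx) ltNge (ltW cx) gt_eqF // ltNge Mx.
have g_lo x : x <= c -> c <= g x /\ g x <= M.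
  rewrite le_eqVlt => /predU1P[->|xc]; first by rewrite g_c; split=> //; exact: ltW.
  have [xp|px] := leP x p; first by rewrite g_bot //; split=> //; exact: ltW.
  by rewrite g_mid //; have [/ltW ? /ltW] : c < psi x /\ psi x < M by apply: psicM.
have g_hi x : c < x -> Y (g x) /\ g x <= c.
  move=> cx; have [Mx|xM] := leP M x; first by rewrite g_top.
  by rewrite g_up //; have [? /ltW] : lower_part Y c (phi x) by apply: phiL.
have OPg : OP_restr Y g.
  split; last first.
    move=> _ [x _ <-]; have [/g_lo[cg gM]|/g_hi[]//] := leP x c.
    by apply: Yz_M => //; apply: lt_le_trans cg.
  apply: (blocks_orientation_preserving c [set x | x <= c]).
  - move=> x y /= xc; rewrite le_eqVlt => /predU1P[->|yc] xy.
      by rewrite g_c; case: (g_lo _ xc).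
    have [xp|px] := leP x p.
      by rewrite g_bot //; case: (g_lo _ (ltW yc)).
    have py := lt_le_trans px xy; have xc' := le_lt_trans xy yc.
    by rewrite !g_mid //; apply: mpsi.
  - move=> x y /= /negP; rewrite -ltNge => cx /negP; rewrite -ltNge => cy xy.
    have [My|yM] := leP M y; first by rewrite (g_top y) //; case: (g_hi _ cx).
    by have xM := le_lt_trans xy yM; rewrite !g_up //; apply: mphi.
  - move=> x y /= xc /negP; rewrite -ltNge => cy; split.
      exact: le_lt_trans cy.
    exact: le_trans (g_hi _ cy).2 (g_lo _ xc).1.
have nOg : ~ O_restr Y g.
  move=> [/order_preserving_onP mg _].
  by have := mg c M I I (ltW cM); rewrite g_c g_top // leNgt cM.
(* Points below the interior of Y are sent to c, so that s stays monotone below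
   c although its values on that interior lie above c. *)
pose s x := if x < c then (if x \in lower_part Y c then phi' x else c)
  else if x == c then p else if x < M then psi' x else c.
have s_L x : lower_part Y c x -> s x = phi' x.
  by move=> Lx; have [_ xc _] := Lx; rewrite /s xc mem_set.
have s_nL x : x < c -> ~ lower_part Y c x -> s x = c.
  by move=> xc nLx; rewrite /s xc memNset.
have s_c : s c = p by rewrite /s ltxx eqxx.
have s_mid x : c < x -> x < M -> s x = psi' x.
  by move=> cx xM; rewrite /s ltNge (ltW cx) gt_eqF // xM.
have s_top x : M <= x -> s x = c.
  move=> Mx; have cx := lt_le_trans cM Mx.
  by rewrite /s ltNge (ltW cx) gt_eqF // ltNge Mx.
have s_lo x : x < c -> c <= s x /\ s x <= M.
  move=> xc; have [Lx|nLx] := pselect (lower_part Y c x).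
    by rewrite s_L //; have [/ltW ? /ltW] : c < phi' x /\ phi' x < M
      by apply: phi'cM.
  by rewrite s_nL //; split=> //; exact: ltW.
have s_hi x : c <= x -> p <= s x /\ s x <= c.
  rewrite le_eqVlt => /predU1P[<-|cx]; first by rewrite s_c; split=> //; exact: ltW.
  have [Mx|xM] := leP M x; first by rewrite s_top //; split=> //; exact: ltW.
  by rewrite s_mid //; have [/ltW ? /ltW] : p < psi' x /\ psi' x < c
    by apply: psi'pc.
have ms_hi x y : c <= x -> x <= y -> s x <= s y.
  move=> cx xy; have cy := le_trans cx xy.
  have [My|yM] := leP M y; first by rewrite (s_top y) //; case: (s_hi _ cx).
  move: cx; rewrite le_eqVlt => /predU1P[<-|cx].
    by rewrite s_c; case: (s_hi _ cy).
  have xM := le_lt_trans xy yM; have cy' := lt_le_trans cx xy.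
  by rewrite !s_mid // mpsi'.
have ms_L x y : lower_part Y c x -> lower_part Y c y -> x <= y -> s x <= s y.
  by move=> Lx Ly xy; rewrite !s_L // mphi'.
have s_ge_p x : p <= s x.
  have [/s_hi[]//|/s_lo[cs _]] := leP c x; exact: le_trans (ltW pc) cs.
have OPs : OP_restr Y s.
  split; last first.
    move=> _ [x _ <-]; apply: Yz_M; first exact: lt_le_trans (s_ge_p x).
    have [/s_hi[_ sc]|/s_lo[]//] := leP c x; exact: le_trans sc (ltW cM).
  apply: (blocks_orientation_preserving c [set x | x < c]).
  - move=> x y /= xc yc xy; have [Lx|nLx] := pselect (lower_part Y c x).
      apply: ms_L => //; have [Yx _ [w Yw wx]] := Lx; split=> //.
        have := xy; rewrite le_eqVlt => /predU1P[<-//|xy'].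
        exact: Ycvx xy' yc.
      by exists w => //; apply: lt_le_trans xy.
    by rewrite (s_nL x) //; case: (s_lo _ yc).
  - by move=> x y /= /negP; rewrite -leNgt => cx _; apply: ms_hi.
  - move=> x y /= xc /negP; rewrite -leNgt => cy; split.
      exact: lt_le_trans cy.
    exact: le_trans (s_hi _ cy).2 (s_lo _ xc).1.
exists g, s; split=> //.
- split=> // x y [_ xc _] cy.
  exact: le_trans (s_hi _ cy).2 (s_lo _ xc).1.
- move=> y Ly; have [cs sM] : c < phi' y /\ phi' y < M by apply: phi'cM.
  by rewrite s_L // g_up // phiK.
- move=> y cy; rewrite le_eqVlt => /predU1P[->|yM].
    by rewrite s_top // g_c.
  move: cy; rewrite le_eqVlt => /predU1P[<-|cy]; first by rewrite s_c g_bot.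
  have [ps sc] : p < psi' y /\ psi' y < c by apply: psi'pc.
  by rewrite s_mid // g_mid // psiK.
Qed.

(** * Relative rank when [Y] has a maximum *)

Lemma relative_rank_max Y : dense_chain X -> no_gap_cut X ->
  homogeneous_chain X -> convex Y -> has_max Y ->
  (exists y1 y2, [/\ Y y1, Y y2 & y1 <> y2]) ->
  relative_rank_is (OP_restr Y) (O_restr Y) `I_1.
Proof.
move=> Xdense Xcut Xhom Ycvx [M YM ubM] [y1 [y2 [Yy1 Yy2 y12]]].
have [z Yz zM] : exists2 z, Y z & z < M.
  have [y1M|y1M] := eqVneq y1 M; last first.
    by exists y1 => //; rewrite lt_neqAle ubM // andbT.
  exists y2 => //; rewrite lt_neqAle ubM // andbT; apply/eqP => y2M.
  by apply: y12; rewrite y1M.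
have [p [zp pM]] := Xdense _ _ zM; have [c [pc cM]] := Xdense _ _ pM.
have Yz_M x : z < x -> x <= M -> Y x.
  by move=> zx; rewrite le_eqVlt => /predU1P[->//|]; apply: Ycvx zx.
have [g [s [[OPg nOg OPs] [s_p s_hi s_L s_L_hi] gsL gs_hi]]] :=
  rotation_with_section Y z p c M Xdense Xhom Ycvx Yz YM zp pc cM.
have YO : Y !=set0 by exists z.
apply: (@relative_rank1 _ _ _ g) => //.
- exact: product_closed_OP_restr.
- exact: product_closed_O_restr.
- exact: sub_O_OP_restr.
have clG := product_closed_generated _ (O_restr Y `|` [set g]).
have Gg : generated_semigroup (O_restr Y `|` [set g]) g.
  by apply: sub_generated; right.
have GO f : O_restr Y f -> generated_semigroup (O_restr Y `|` [set g]) f.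
  by move=> Of; apply: sub_generated; left.
have [e1 [e1_le e1_c e1_M]] := order_embedding_interval c M Xdense Xhom cM.
have [e2 [e2_le e2_p e2_c]] := order_embedding_interval p c Xdense Xhom pc.
have e2L x : lower_part Y c (e2 x).
  have zx : z < e2 x := lt_trans zp (e2_p x).
  split=> //; last by exists z.
  apply: Yz_M => //; exact/ltW/(lt_trans (e2_c x)).
(* The maps bounded below in Y factor through a single use of g. *)
have bounded_gen h b : OP_restr Y h -> Y b -> (forall x, b <= h x) ->
    generated_semigroup (O_restr Y `|` [set g]) h.
  move=> [OPh Yh] Yb bh.
  have [A [hA hC hAC]] := orientation_preserving_blocks _ OPh.
  pose e x := if x \in A then e1 x else e2 x.
  have eA x : A x -> e x = e1 x by move=> Ax; rewrite /e mem_set.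
  have eC x : ~ A x -> e x = e2 x by move=> nAx; rewrite /e memNset.
  have hM x : h x <= M by apply: ubM; apply: Yh; exists x.
  have eh x y : e x <= e y -> h x <= h y.
    have [Ax|nAx] := pselect (A x); have [Ay|nAy] := pselect (A y).
    - by rewrite !eA // e1_le; apply: hA.
    - by rewrite eA // eC // leNgt (lt_trans (e2_c y) (e1_c x)).
    - by move=> _; case: (hAC _ _ Ay nAx).
    - by rewrite !eC // e2_le; apply: hC.
  have [k [mk bk kM ke]] := order_preserving_interpolation e h b M Xcut bh hM eh.
  have Ok : O_restr Y k.
    split; first by apply/order_preserving_onP => x y _ _; apply: mk.
    move=> _ [x _ <-]; have := bk x; rewrite le_eqVlt => /predU1P[<-//|bkx].
    have := kM x; rewrite le_eqVlt => /predU1P[->//|kxM].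
    exact: Ycvx bkx kxM.
  have Ose : O_restr Y (s \o e).
    split; last by move=> _ [x _ <-]; apply: OPs.2; exists (e x).
    apply/order_preserving_onP => x y _ _ xy /=.
    have [Ax|nAx] := pselect (A x); have [Ay|nAy] := pselect (A y).
    - by rewrite !eA //; apply: s_hi; [exact/ltW/e1_c | rewrite e1_le].
    - by rewrite eA // eC //; apply: s_L_hi => //; exact/ltW/e1_c.
    - by have := (hAC _ _ Ay nAx).1; rewrite ltNge xy.
    - by rewrite !eC //; apply: s_L; rewrite ?e2_le.
  have gse x : g (s (e x)) = e x.
    have [Ax|nAx] := pselect (A x); last by rewrite eC // gsL.
    by rewrite eA // gs_hi //; exact/ltW.
  have -> : h = ((s \o e) \; g) \; k by apply/funext => x /=; rewrite gse ke.
  exact: (clG _ _ (clG _ _ (GO _ Ose) Gg) (GO _ Ok)).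
move=> f OPf.
have [[b Yb bf]|nobound] := pselect (exists2 b, Y b & forall x, b <= f x).
  exact: bounded_gen bf.
(* Since f x is not a lower bound of f, it is not the minimum of Y. *)
have gsf x : g (s (f x)) = f x.
  have Yfx : Y (f x) by apply: OPf.2; exists x.
  have [cfx|fxc] := leP c (f x); first by rewrite gs_hi // ubM.
  apply: gsL; split=> //.
  have /existsNP[w /negP] : ~ forall w, f x <= f w.
    by move=> fx; apply: nobound; exists (f x).
  by rewrite -ltNge => wx; exists (f w) => //; apply: OPf.2; exists w.
have -> : f = (f \; s) \; g by apply/funext => x /=; rewrite gsf.
apply: clG => //; apply: (bounded_gen _ p).
- exact: product_closed_OP_restr.
- by apply: Yz_M => //; exact: ltW.
- by move=> x; apply: s_p.
Qed.

End Chain.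

(** * The dual chain *)

Section Dual.
Context {d : Order.disp_t} {X : orderType d}.
Implicit Types (A B Y : set X) (f : X -> X).

Lemma order_preserving_on_dual A f :
  order_preserving_on (X := X^d) A f <-> order_preserving_on A f.
Proof. by split=> mf x y Ax Ay; apply: mf. Qed.

Lemma convex_dual A : convex A -> convex (X := X^d) A.
Proof. by move=> cA x y z Ax Ay xz zy; apply: cA zy xz. Qed.

Lemma open_convex_dual A : open_convex (X := X^d) A -> open_convex A.
Proof.
move=> [A0 cA nmin nmax]; split=> //.
by move=> x y z Ax Ay xz zy; apply: cA zy xz.
Qed.

Lemma dense_chain_dual : dense_chain X -> dense_chain X^d.
Proof. by move=> Xdense x y xy; have [z [? ?]] := Xdense y x xy; exists z. Qed.

Lemma no_gap_cut_dual : no_gap_cut X -> no_gap_cut X^d.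
Proof.
move=> Xcut A B AB ltAB A0 B0.
have BA : B `|` A = [set: X] by exact: etrans (setUC _ _) AB.
have ltBA : set_lt (X := X) B A by move=> b a Bb Aa; apply: ltAB.
by have [] := Xcut B A BA ltBA B0 A0; [right | left].
Qed.

Lemma homogeneous_chain_dual : homogeneous_chain X -> homogeneous_chain X^d.
Proof.
move=> Xhom A B /open_convex_dual oA /open_convex_dual oB.
have [f bf mf] := Xhom A B oA oB; exists f => //.
exact/order_preserving_on_dual.
Qed.

Lemma O_restr_dual Y : O_restr (X := X^d) Y = O_restr Y.
Proof.
by apply/seteqP; split=> f [mf Yf]; split=> //; apply/order_preserving_on_dual.
Qed.

(** In the dual chain the two blocks exchange their roles. *)
Lemma orientation_preserving_dual f :
  orientation_preserving (X := X^d) f <-> orientation_preserving f.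
Proof.
split=> OPf; have [x0 _] : [set: X] !=set0 by case: OPf => A [x0 _] _; exists x0.
  have [A [fA fC fAC]] := orientation_preserving_blocks _ OPf.
  apply: (blocks_orientation_preserving x0 (~` A)).
  - by move=> x y nAx nAy xy; apply: fC.
  - by move=> x y /contrapT Ax /contrapT Ay xy; apply: fA.
  - by move=> x y nAx /contrapT Ay; apply: fAC.
have [A [fA fC fAC]] := orientation_preserving_blocks _ OPf.
apply: (@blocks_orientation_preserving _ X^d x0 (~` A)).
- by move=> x y nAx nAy xy; apply: fC.
- by move=> x y /contrapT Ax /contrapT Ay xy; apply: fA.
- by move=> x y nAx /contrapT Ay; apply: fAC.
Qed.

Lemma OP_restr_dual Y : OP_restr (X := X^d) Y = OP_restr Y.
Proof.
by apply/seteqP; split=> f [mf Yf]; split=> //; apply/orientation_preserving_dual.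
Qed.

End Dual.

Theorem theorem11 (d : Order.disp_t) (X : orderType d)
  (Xinfinite : infinite_set [set: X])
  (Xdense : dense_chain X)
  (Xcut : no_gap_cut X)
  (Xhom : homogeneous_chain X)
  (Xend : has_min [set: X] \/ has_max [set: X])
  (Y : set X)
  (Yneq0 : Y !=set0)
  (Yproper : Y `<` [set: X])
  (Yconvex : convex Y)
  (Yend : has_min Y \/ has_max Y)
  (Ynontrivial : exists y1 y2, [/\ Y y1, Y y2 & y1 <> y2]) :
  relative_rank_is (OP_restr Y) (O_restr Y) `I_1.
Proof.
case: Yend => [Ymin|Ymax]; last first.
  exact: (relative_rank_max Y Xdense Xcut Xhom Yconvex Ymax Ynontrivial).
have rank_dual :
    relative_rank_is (OP_restr (X := X^d) Y) (O_restr (X := X^d) Y) `I_1.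
  apply: (@relative_rank_max _ X^d Y) => //.
  - exact: dense_chain_dual.
  - exact: no_gap_cut_dual.
  - exact: homogeneous_chain_dual.
  - exact: convex_dual.
by move: rank_dual; rewrite OP_restr_dual O_restr_dual.
Qed.
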